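(* Let $n\ge1$ and $i\in\{0,\dots,n+1\}$. If $C$ and $D$ are $(n,i)$-composers, then the function complex $D^C$ is also an $(n,i)$-composer.
   Context: $[m]=\{0,\dots,m\}$. For a simplicial set $C$, $\Lambda^i(m)(C)$ is the set of families $(x_j)_{j\in[m]\setminus\{i\}}$ in $C_{m-1}$ with $d_p(x_q)=d_{q-1}(x_p)$ for all $p<q$ in $[m]\setminus\{i\}$. For $n\ge1$, $i\in[n+1]$, an $(n,i)$-composer is a simplicial set $C$ such that for every $m>n$ the map $C_m\to\Lambda^i(m)(C)$, $y\mapsto(d_j(y))_{j\ne i}$, is a bijection. The function complex $D^C$ is the simplicial set whose $k$-simplices are the simplicial maps $C\times\Delta[k]\to D$, with face and degeneracy operators induced by the coface and codegeneracy maps between the standard simplices $\Delta[k]$. *)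

(* Defs.v *)
From HB Require Import structures.
From mathcomp Require Import all_boot all_order.
From mathcomp Require Import boolp.

Set Implicit Arguments.
Unset Strict Implicit.
Unset Printing Implicit Defensive.

Import Order.Theory.

(* Morphisms [m] -> [n] of the simplex category, with [m] = {0, ..., m} = 'I_m.+1. *)
Notation "m ~>D n" := ({omorphism 'I_m.+1 -> 'I_n.+1})
  (at level 70, no associativity) : type_scope.

Lemma mono_ext (m n : nat) (f g : m ~>D n) : (f : _ -> _) =1 g -> f = g.
Proof.
case: f g => f [[hf]] [g [[hg]]] /= /funext fg; subst g.
by rewrite (Prop_irrelevance hf hg).
Qed.

Definition coface (m : nat) (j : 'I_m.+2) : 'I_m.+1 -> 'I_m.+2 := lift j.

Lemma coface_mono (m : nat) (j : 'I_m.+2) : {homo coface j : x y / (x <= y)%O}.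
Proof. by move=> x y; rewrite !leEord /= leq_bump2. Qed.

HB.instance Definition _ (m : nat) (j : 'I_m.+2) :=
  Order.isOrderMorphism.Build _ 'I_m.+1 _ 'I_m.+2 (coface j) (@coface_mono m j).

(* Faces and degeneracies are the actions of the cofaces and codegeneracies. *)
Record sset := SSet {
  simp :> nat -> Type;
  act : forall m n : nat, m ~>D n -> simp n -> simp m;
  act_id : forall (n : nat) (x : simp n), act (idfun : n ~>D n) x = x;
  act_comp : forall (l m n : nat) (f : l ~>D m) (g : m ~>D n) (x : simp n),
    act (g \o f : l ~>D n) x = act f (act g x) }.

Arguments act X [m n] f x : rename.

(* The face index j is a natural number; inord makes it junk when j > m.+1. *)
Definition face (X : sset) (m : nat) (j : nat) (x : X m.+1) : X m :=
  act X (coface (inord j : 'I_m.+2) : m ~>D m.+1) x.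

Record smap (X Y : sset) := SMap {
  smap_fun :> forall m : nat, X m -> Y m;
  smap_nat : forall (m n : nat) (f : m ~>D n) (x : X n),
    smap_fun (act X f x) = act Y f (smap_fun x) }.

Lemma smap_ext (X Y : sset) (u v : smap X Y) :
  (forall m (x : X m), u m x = v m x) -> u = v.
Proof.
case: u v => u hu [v hv] /= uv.
have e : u = v by apply: functional_extensionality_dep => m; apply: funext => x.
by subst v; rewrite (Prop_irrelevance hu hv).
Qed.

Definition std_act (k m n : nat) (f : m ~>D n) (a : n ~>D k) : m ~>D k := a \o f.

Lemma std_act_id (k n : nat) (a : n ~>D k) : std_act (idfun : n ~>D n) a = a.
Proof. exact: mono_ext. Qed.

Lemma std_act_comp (k l m n : nat) (f : l ~>D m) (g : m ~>D n) (a : n ~>D k) :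
  std_act (g \o f : l ~>D n) a = std_act f (std_act g a).
Proof. exact: mono_ext. Qed.

(* Delta[k] *)
Definition std (k : nat) : sset :=
  @SSet (fun m => m ~>D k) (@std_act k) (@std_act_id k) (@std_act_comp k).

Definition std_map (k l : nat) (t : k ~>D l) : smap (std k) (std l) :=
  @SMap (std k) (std l) (fun m (a : m ~>D k) => (t \o a : m ~>D l))
    (fun m n (f : m ~>D n) (a : n ~>D k) =>
       @mono_ext m l (t \o std_act f a) (std_act f (t \o a : n ~>D l))
         (fun=> erefl)).

Section Product.
Variables X Y : sset.

Definition prod_act (m n : nat) (f : m ~>D n) (z : X n * Y n) : X m * Y m :=
  (act X f z.1, act Y f z.2).

Lemma prod_act_id (n : nat) (z : X n * Y n) : prod_act (idfun : n ~>D n) z = z.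
Proof. by case: z => x y; rewrite /prod_act !act_id. Qed.

Lemma prod_act_comp (l m n : nat) (f : l ~>D m) (g : m ~>D n) (z : X n * Y n) :
  prod_act (g \o f : l ~>D n) z = prod_act f (prod_act g z).
Proof. by rewrite /prod_act !act_comp. Qed.

Definition sprod : sset :=
  @SSet (fun m => (X m * Y m)%type) prod_act prod_act_id prod_act_comp.
End Product.

Section FunctionComplex.
Variables D C : sset.

Lemma fun_act_nat (k l : nat) (t : k ~>D l) (u : smap (sprod C (std l)) D)
    (m n : nat) (f : m ~>D n) (z : sprod C (std k) n) :
  u m ((act (sprod C (std k)) f z).1, std_map t m (act (sprod C (std k)) f z).2) =
  act D f (u n (z.1, std_map t n z.2)).
Proof. by rewrite -smap_nat; congr (u m (_, _)); apply: mono_ext. Qed.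

(* Precomposition with id_C x Delta[t]. *)
Definition fun_act (k l : nat) (t : k ~>D l) (u : smap (sprod C (std l)) D) :
    smap (sprod C (std k)) D :=
  @SMap (sprod C (std k)) D
    (fun m (z : sprod C (std k) m) => u m (z.1, std_map t m z.2)) (fun_act_nat t u).

Lemma fun_act_id (k : nat) (u : smap (sprod C (std k)) D) :
  fun_act (idfun : k ~>D k) u = u.
Proof.
apply: smap_ext => m [x a] /=; congr (u m (x, _)).
exact: mono_ext.
Qed.

Lemma fun_act_comp (j k l : nat) (s : j ~>D k) (t : k ~>D l)
    (u : smap (sprod C (std l)) D) :
  fun_act (t \o s : j ~>D l) u = fun_act s (fun_act t u).
Proof.
apply: smap_ext => m [x a] /=; congr (u m (x, _)).
exact: mono_ext.
Qed.

(* D^C *)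
Definition fun_complex : sset :=
  @SSet (fun k => smap (sprod C (std k)) D) fun_act fun_act_id fun_act_comp.
End FunctionComplex.

Lemma face_face (X : sset) (m p q : nat) (y : X m.+2) :
  p < q -> q < m.+3 -> face p (face q y) = face q.-1 (face p y).
Proof.
move=> pq qm; rewrite /face -!act_comp; congr (act X _ y); apply: mono_ext => x.
have hq : q.-1 < m.+2 by case: q pq qm.
have hp : p < m.+2 by apply: leq_trans pq _.
apply: val_inj; rewrite /= !inordK // ?(ltnW hp) //; last by apply: ltnW.
case: q pq {qm hq} => // q; rewrite ltnS => pq /=; rewrite bumpC.
by rewrite /unbump ltnS pq subn1 /= [bump q.+1 p]/bump ltnNge pq.
Qed.

(* Lambda^i(m.+2)(C): the dimension is written m.+2 so that the members of the family,
   of dimension m.+1, have faces. *)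
Record horn (C : sset) (i m : nat) := Horn {
  horn_mem :> {j : 'I_m.+3 | (j : nat) != i} -> C m.+1;
  horn_compat : forall p q : {j : 'I_m.+3 | (j : nat) != i},
    val p < val q ->
    face (val p) (horn_mem q) = face (val q).-1 (horn_mem p) }.

Definition boundary_horn (C : sset) (i m : nat) (y : C m.+2) : horn C i m :=
  @Horn C i m (fun j => face (val j) y)
    (fun p q pq => @face_face C m (val p) (val q) y pq (ltn_ord (val q))).

(* For n >= 1 the integers > n are exactly the m.+2 with n < m.+2. *)
Definition is_composer (n : nat) (i : 'I_n.+2) (C : sset) : Prop :=
  forall m : nat, n < m.+2 -> bijective (@boundary_horn C i m).

(* Main.v *)
From HB Require Import structures.
Require Import Defs.
From mathcomp Require Import all_boot all_order.
From mathcomp Require Import boolp zify.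

Set Implicit Arguments.
Unset Strict Implicit.
Unset Printing Implicit Defensive.

(** A horn of shape Lambda^i[m] in D^C is a map from C x Lambda^i[m] to D, and the
claim is that for m > n it extends to C x Delta[m] in exactly one way. Two ideas
give this.

The first is that a composer D is governed by its simplices of dimension at most
n + 1. Suppose that values in D are prescribed, compatibly with all operators, at
the simplices of dimension at most n of a simplicial set X. A realizer of a simplex
x of X is a simplex w of D such that f^* w is the value prescribed at f^* x, for
every operator f out of some [k] with k <= n. Realizers are unique and stable under
operators. If all faces of x other than the i-th have realizers and dim x >= n + 2,
filling their horn gives a realizer of x, because an operator from [k], k <= n, into
a target of that dimension factors through a coface other than the i-th. Hence the
prescribed values extend to a map X -> D as soon as every (n+1)-simplex of X has a
realizer (realizer_smap). Degeneracies need no separate treatment.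

The second concerns the pairs (c, a) of C x Delta[m] of dimension at most n + 1. If
the image of a omits some j <> i, the horn in D^C prescribes the value. Otherwise a
is onto, or a = d^i f with f onto. The value at a pair (b, d^i) is forced: it is the
i-th face of the filler of the horn that D receives at (s^* b, id), where s is a
codegeneracy with s d^i = id. When m = n + 1 it remains to realize the (n+1)-simplices
(c, id) and (c, d^i f), and both cases follow from one principle
(realizable_omitted): if all faces of an (n+2)-simplex have realizers except possibly
one, numbered i or i + 1, then that one has a realizer as well. For the index i this
is horn filling. For i + 1, horn filling first gives a candidate for the missing
realizer, whose i-th face is not under control; a second filling, one dimension
higher, identifies it with the i-th face of the realizer of the i-th face.

- For (c, id) the (n+2)-simplex is (e, s^i) with e a degeneracy of c. Its faces
  numbered i and i + 1 are (c, id) and (s^* d_i c, id), in one order or the other;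
  the latter has a realizer by the choice of the values at the pairs (b, d^i), and
  the remaining faces lie over the horn.
- For (c, d^i f) the (n+2)-simplex is (e, a'), where a' arises from d^i f by
  inserting the value i. It is inserted at position i or i + 1, because f is onto
  with a domain only one larger than its target. The other faces are over the horn
  or of the form (c', id). *)

(** * Monotone maps *)

Definition delta (m j : nat) : m ~>D m.+1 := coface (inord j : 'I_m.+2).

Lemma deltaE m j (t : 'I_m.+1) : j <= m.+1 -> delta m j t = (j <= t) + t :> nat.
Proof. by move=> jm; rewrite /delta /= inordK. Qed.

Definition mono_of k l (g : 'I_k.+1 -> 'I_l.+1)
    (hg : forall x y : 'I_k.+1, (x : nat) <= y -> (g x : nat) <= g y) : k ~>D l :=
  HB.pack g (Order.isOrderMorphism.Build _ 'I_k.+1 _ 'I_l.+1 g hg).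

Lemma mono_le k l (f : k ~>D l) (x y : 'I_k.+1) : (x : nat) <= y -> (f x : nat) <= f y.
Proof.
move=> xy; have := @Order.OrderMorphismTheory.omorph_le _ _ _ _ f x y.
by rewrite !leEord; apply.
Qed.

(** The truncation by k makes the formula monotone for every p, so that p need not be
bundled with a proof of p <= k. *)
Definition sigma_fun k p (t : 'I_k.+2) : 'I_k.+1 := inord (minn (t - (p < t)) k).

Lemma sigma_mono k p (x y : 'I_k.+2) :
  (x : nat) <= y -> (sigma_fun p x : nat) <= sigma_fun p y.
Proof. by move=> xy; rewrite /sigma_fun !inordK; lia. Qed.

Definition sigma k p : k.+1 ~>D k := mono_of (@sigma_mono k p).

Lemma sigmaE k p (t : 'I_k.+2) : p <= k -> sigma k p t = t - (p < t) :> nat.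
Proof. by move=> pk; rewrite /= /sigma_fun inordK; have := ltn_ord t; lia. Qed.

Lemma val_mono_ext k l (f g : k ~>D l) : (forall t, f t = g t :> nat) -> f = g.
Proof. by move=> fg; apply: mono_ext => t; apply: val_inj; apply: fg. Qed.

Definition misses k l (f : k ~>D l) (j : nat) := forall t, (f t : nat) != j.
Definition onto k l (f : k ~>D l) := forall j, j <= l -> exists t, f t = j :> nat.

Lemma missP k l (f : k ~>D l) j : misses f j \/ exists t, f t = j :> nat.
Proof.
case: (pselect (exists t, f t = j :> nat)) => h; first by right.
by left=> t; apply/eqP => e; apply: h; exists t.
Qed.

Lemma misses_delta m j : j <= m.+1 -> misses (delta m j) j.
Proof. by move=> jm t; rewrite deltaE //; lia. Qed.

(** The predecessor lets a single formula supply a retraction of every coface, the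
0-th one included: it is s^0 for d^0 and s^(j-1) for d^j with j > 0. *)
Lemma sigma_delta m j : j <= m.+1 -> (sigma m j.-1 \o delta m j : m ~>D m) = idfun.
Proof.
move=> jm; apply: val_mono_ext => t; rewrite [LHS]sigmaE ?deltaE //=; last lia.
by case: j jm; lia.
Qed.

Lemma misses_factor k l (f : k ~>D l.+1) j : j <= l.+1 -> misses f j ->
  f = (delta l j \o (sigma l j.-1 \o f : k ~>D l) : k ~>D l.+1).
Proof.
move=> jl fj; apply: val_mono_ext => t.
rewrite [RHS]deltaE //.
have e : (sigma l j.-1 \o f) t = f t - (j.-1 < f t) :> nat by apply: sigmaE; lia.
by rewrite e; have := fj t; case: j jl fj {e}; lia.
Qed.

Lemma delta_inj m j (x y : 'I_m.+1) : j <= m.+1 -> delta m j x = delta m j y -> x = y.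
Proof.
move=> jm /(congr1 val) /=; rewrite -!/(nat_of_ord _) => e; apply: val_inj => /=.
by have := deltaE x jm; have := deltaE y jm => /=; lia.
Qed.

(** A monotone surjection starts at 0, ends at l and never skips a value, so it climbs
by at most 1 at each step, counted from either end. This replaces the decomposition
of surjections into codegeneracies: surjections [k] -> [l] with k - l at most 1 are
all that occurs below. *)
Lemma onto_bounds k l (f : k ~>D l) : onto f ->
  forall t : 'I_k.+1, f t <= t /\ t + l <= f t + k.
Proof.
move=> hf t; split.
  suff H s : forall t : 'I_k.+1, t = s :> nat -> f t <= s by apply: H.
  elim: s => [|s IH] {}t ts.
    by have [u <-] := hf 0 isT; apply: mono_le; lia.
  have sk : s < k.+1 by have := ltn_ord t; lia.
  have := IH (Ordinal sk) erefl; set p := Ordinal sk => fp.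
  rewrite leqNgt; apply/negP => lt.
  have [|u fu] := hf s.+1; first by have := ltn_ord (f t); lia.
  case: (leqP u s) => us.
    by have := @mono_le _ _ f u p us; lia.
  by have := @mono_le _ _ f t u; lia.
suff H s : forall t : 'I_k.+1, t + s = k -> l <= f t + s.
  by have := ltn_ord t => tk; have := H (k - t) t; lia.
elim: s => [|s IH] {}t ts.
  by have [u fu] := hf l (leqnn _); have := @mono_le _ _ f u t; have := ltn_ord u; lia.
have sk : t.+1 < k.+1 by lia.
have := IH (Ordinal sk); set p := Ordinal sk => /(_ _) fp.
have {}fp := fp (ltac:(rewrite /=; lia)).
rewrite leqNgt; apply/negP => lt.
have [|u fu] := hf (f t).+1; first by have := ltn_ord (f p); lia.
case: (leqP u t) => us.
  by have := @mono_le _ _ f u t us; lia.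
by have := @mono_le _ _ f p u us; lia.
Qed.

Lemma onto_id k (f : k ~>D k) : onto f -> f = idfun.
Proof. by move=> /onto_bounds hf; apply: val_mono_ext => t; have := hf t => /=; lia. Qed.

Lemma onto_dim k l (f : k ~>D l) : onto f -> l <= k.
Proof. by move=> /onto_bounds /(_ ord0) [] /=; lia. Qed.

Lemma misses_or_onto k l (f : k ~>D l) : (exists2 j, j <= l & misses f j) \/ onto f.
Proof.
case: (pselect (exists2 j, j <= l & misses f j)) => h; [by left|right=> j jl].
by case: (missP f j) => // fj; case: h; exists j.
Qed.

Lemma delta_delta m p q : p < q -> q <= m.+2 ->
  (delta m.+1 q \o delta m p : m ~>D m.+2) = (delta m.+1 p \o delta m q.-1 : m ~>D m.+2).
Proof.
move=> pq qm; apply: val_mono_ext => t.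
rewrite [LHS]deltaE // [RHS]deltaE ?deltaE; lia.
Qed.

(** The first alternative says that f lies in the horn Lambda^i[l+1]. *)
Lemma misses_factor_or_onto k l (f : k ~>D l.+1) i : i <= l.+1 ->
  [\/ exists2 j, j <= l.+1 & (j != i) /\ misses f j,
      exists2 g : k ~>D l, onto g & f = (delta l i \o g : k ~>D l.+1) | onto f].
Proof.
move=> il; case: (misses_or_onto f) => [[j jl fj]|]; last by constructor 3.
case: (eqVneq j i) => ji; last by constructor 1; exists j.
subst j; set g : k ~>D l := sigma l i.-1 \o f.
have fE : f = (delta l i \o g : k ~>D l.+1) by apply: misses_factor.
case: (misses_or_onto g) => [[j' j'l gj]|og]; last by constructor 2; exists g.
constructor 1; exists (j' + (i <= j')); first lia.
split; first lia.
move=> t; rewrite fE deltaE //; have /eqP := gj t; lia.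
Qed.

(** Inserting the value i at position p turns a into a map b with p-th face a. When a
omits i, position p is the only one at which b takes the value i; hence the p-th face
of b is the only one that omits i. *)
Lemma insert_value k l (a : k ~>D l) i p : i <= l -> p <= k.+1 ->
  (forall t : 'I_k.+1, t < p -> a t <= i) ->
  (forall t : 'I_k.+1, p <= t -> i <= a t) ->
  exists2 b : k.+1 ~>D l, (b \o delta k p : k ~>D l) = a &
    forall t : 'I_k.+2, t = p :> nat -> b t = i :> nat.
Proof.
move=> il pk alo ahi.
pose b_fun (t : 'I_k.+2) : 'I_l.+1 := if (t : nat) == p then inord i else a (sigma k p.-1 t).
have sE (t : 'I_k.+2) : (t : nat) != p -> sigma k p.-1 t = t - (p < t) :> nat.
  by move=> tp; rewrite sigmaE; lia.
have b_mono (x y : 'I_k.+2) : (x : nat) <= y -> (b_fun x : nat) <= b_fun y.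
  rewrite /b_fun => xy; case: eqP => [xp|/eqP xp]; case: eqP => [yp|/eqP yp] //.
  - by rewrite inordK //; apply: ahi; rewrite sE //; lia.
  - by rewrite inordK //; apply: alo; rewrite sE //; lia.
  - by apply: mono_le; rewrite !sE //; lia.
exists (mono_of b_mono); last by move=> t tp; rewrite /= /b_fun tp eqxx inordK.
apply: val_mono_ext => t; rewrite /= /b_fun.
have /negbTE := misses_delta pk t; rewrite /= => ->.
by congr (nat_of_ord (a _)); have := congr1 (fun f : k ~>D k => f t) (sigma_delta pk).
Qed.

Lemma act_misses k l (Y : sset) (f : k ~>D l.+1) j (y : Y l.+1) :
  j <= l.+1 -> misses f j -> act Y f y = act Y (sigma l j.-1 \o f) (face j y).
Proof. by move=> jl fj; rewrite {1}(misses_factor jl fj) act_comp. Qed.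

(** * Unique horn fillers *)

Lemma horn_ext (C : sset) i m (h h' : horn C i m) :
  (forall j, horn_mem h j = horn_mem h' j) -> h = h'.
Proof.
case: h h' => h hc [h' hc'] /= hh'.
have e : h = h' by apply: functional_extensionality_dep.
subst h'.
by rewrite (Prop_irrelevance hc hc').
Qed.

Lemma bijective_of_inj_surj (A B : Type) (f : A -> B) :
  injective f -> (forall b, exists a, f a = b) -> bijective f.
Proof.
move=> finj fsurj; have [g gK] := choice fsurj.
by exists g => // a; apply: finj; rewrite gK.
Qed.

Section Composer.
Variables (n : nat) (i : 'I_n.+2) (D : sset).
Hypothesis hD : is_composer i D.

Lemma composer_eq m (z z' : D m.+2) : n < m.+2 ->
  (forall l, l <= m.+2 -> l != i -> face l z = face l z') -> z = z'.
Proof.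
move=> nm e; apply: (bij_inj (hD nm)); apply: horn_ext => -[j ji] /=.
by apply: e => //; rewrite -ltnS.
Qed.

(** The members of the horn are given by predicates instead of chosen simplices: in the
applications, simplices with the required property are known only to exist. *)
Lemma composer_fill m (P : nat -> D m.+1 -> Prop) : n < m.+2 ->
  (forall l, l <= m.+2 -> l != i -> exists w, P l w) ->
  (forall p q w w', p < q -> q <= m.+2 -> p != i -> q != i ->
     P p w -> P q w' -> face p w' = face q.-1 w) ->
  exists z : D m.+2, forall l, l <= m.+2 -> l != i -> P l (face l z).
Proof.
move=> nm ex comp.
have /choice [w wP] : forall j : {j : 'I_m.+3 | (j : nat) != i}, exists w, P (val j) w.
  by move=> [j ji]; apply: ex => //; rewrite -ltnS.
have wc (p q : {j : 'I_m.+3 | (j : nat) != i}) :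
    val p < val q -> face (val p) (w q) = face (val q).-1 (w p).
  move=> pq; apply: (comp (val p) (val q)) => //; [|exact: (valP p)|exact: (valP q)].
  by rewrite -ltnS.
have [g _ gK] := hD nm; exists (g (Horn wc)) => l lm li.
have e := congr1 (fun h : horn D i m => horn_mem h
  (exist (fun j : 'I_m.+3 => (j : nat) != i) (Ordinal (lm : l < m.+3)) li)) (gK (Horn wc)).
by move: e => /= ->; apply: (wP (exist _ (Ordinal (lm : l < m.+3)) li)).
Qed.

(** * Realizers of prescribed values *)

Section Realizer.
(* R is the graph of a partial map X -> D: a subcomplex of X x D which, in dimensions at
most n, is the graph of a function. *)
Variables (X : sset) (R : forall k, X k -> D k -> Prop).
Hypothesis R_act : forall k l (f : k ~>D l) x w, R x w -> R (act X f x) (act D f w).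
Hypothesis R_fun : forall k (x : X k) w w', k <= n -> R x w -> R x w' -> w = w'.
Hypothesis R_tot : forall k (x : X k), k <= n -> exists w, R x w.

Definition realizes k (x : X k) (w : D k) :=
  forall l (f : l ~>D k), l <= n -> R (act X f x) (act D f w).

Lemma R_realizes k (x : X k) w : R x w -> realizes x w.
Proof. by move=> xw l f _; apply: R_act. Qed.

Lemma realizes_R k (x : X k) w : k <= n -> realizes x w -> R x w.
Proof. by move=> kn /(_ k idfun kn); rewrite !act_id. Qed.

Lemma realizes_act k l (f : k ~>D l) x w :
  realizes x w -> realizes (act X f x) (act D f w).
Proof. by move=> xw j g jn; rewrite -!act_comp; apply: xw. Qed.

Lemma realizes_face k j (x : X k.+1) w :
  realizes x w -> realizes (face j x) (face j w).
Proof. exact: realizes_act. Qed.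

(** An operator f into [k+1] from a lower dimension is not onto, so it factors through
some coface. *)
Lemma realizes_of_faces k (x : X k.+1) w : n <= k ->
  (forall l, l <= k.+1 -> realizes (face l x) (face l w)) -> realizes x w.
Proof.
move=> nk xw l f ln; case: (misses_or_onto f) => [[j jk fj]|/onto_dim]; last lia.
by rewrite !(act_misses _ jk fj); apply: xw.
Qed.

(** With k > n, an operator f from [l], l <= n, into [k+1] cannot omit only the vertex i:
it would factor through d^i by a surjection [l] -> [k]. *)
Lemma realizes_of_horn k (x : X k.+1) w : n < k ->
  (forall l, l <= k.+1 -> l != i -> realizes (face l x) (face l w)) -> realizes x w.
Proof.
move=> nk xw l f ln; have ik : i <= k.+1 by have := ltn_ord i; lia.
case: (misses_factor_or_onto f ik) => [[j jk [ji fj]]|[g /onto_dim]|/onto_dim]; [|lia|lia].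
by rewrite !(act_misses _ jk fj); apply: xw.
Qed.

Hypothesis n_gt0 : 0 < n.

(** In dimensions at most n, a realizer is the prescribed value; above, it is determined
by the realizers of its faces through the uniqueness of horn fillers. *)
Lemma realizes_uniq k (x : X k) w w' : realizes x w -> realizes x w' -> w = w'.
Proof.
elim/ltn_ind: k x w w' => k IH x w w' xw xw'.
case: (leqP k n) => kn.
  exact: (R_fun kn (realizes_R kn xw) (realizes_R kn xw')).
case: k IH x w w' xw xw' kn => [//|[|k]] IH x w w' xw xw' kn; first lia.
apply: composer_eq => // l lk li.
by apply: (IH k.+1 (ltnSn _) (face l x)); apply: realizes_face.
Qed.

Definition realizable k (x : X k) := exists w, realizes x w.

(** The realizers of the faces of x are compatible, since both sides of each equation
realize the same simplex. *)
Lemma realizable_horn k (x : X k.+2) : n < k.+2 ->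
  (forall l, l <= k.+2 -> l != i -> realizable (face l x)) ->
  exists w, forall l, l <= k.+2 -> l != i -> realizes (face l x) (face l w).
Proof.
move=> nk ex; apply: (composer_fill (P := fun l w => realizes (face l x) w)) => //.
move=> p q w w' pq qk _ _ xw xw'.
apply: (@realizes_uniq _ (face p (face q x))); first exact: realizes_face.
by rewrite face_face //; apply: realizes_face.
Qed.

Lemma realizable_of_horn k (x : X k.+2) : n <= k ->
  (forall l, l <= k.+2 -> l != i -> realizable (face l x)) -> realizable x.
Proof.
move=> nk ex; have [|w wP] := realizable_horn _ ex; first lia.
by exists w; apply: (realizes_of_horn (k := k.+1)).
Qed.

Lemma realizable_face k j (x : X k.+1) : realizable x -> realizable (face j x).
Proof. by case=> w xw; exists (face j w); apply: realizes_face. Qed.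

Lemma realizable_low k (x : X k) : k <= n -> realizable x.
Proof. by move=> /(R_tot x) [w xw]; exists w; apply: R_realizes. Qed.

(** Let x' be the (i+1)-st face of x. Its faces have realizers for dimension reasons, and
filling their horn gives w with all faces correct except possibly the i-th. Now fill
the i-horn formed by w in position i + 1 and the realizers of the other faces of x;
call the result z. The faces of d_i z other than the i-th are correct, hence d_i z is
the realizer vi of the i-th face of x. Therefore d_i w = d_i d_(i+1) z = d_i d_i z =
d_i vi is correct too. The variable k stands for n, on which the type of i depends, so
that it can be written as a successor. *)
Lemma realizable_swap k (x : X k.+2) : k = n ->
  (forall l, l <= k.+2 -> l != i.+1 -> realizable (face l x)) ->
  realizable (face i.+1 x).
Proof.
move=> kn ex; have iln : i <= k.+1 by rewrite kn -ltnS.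
case: k x kn ex iln => [|m] x kn ex im; first lia.
set x' := face i.+1 x.
have [||w wP] := @realizable_horn _ x'; first lia.
  by move=> l _ _; apply: realizable_low; lia.
pose P q (v : D m.+2) := if q == i.+1 then v = w else realizes (face q x) v.
have P_face q v l : P q v -> l <= m.+2 -> (q = i.+1 -> l != i) ->
    realizes (face l (face q x)) (face l v).
  rewrite /P; case: eqP => [-> -> lm li|_ xv _ _]; last exact: realizes_face.
  by apply: wP => //; apply: li.
have [||p q v v' pq qm pi qi pv qv'|z zP] := composer_fill (m := m.+1) (P := P).
- lia.
- move=> l lm li; rewrite /P; case: eqP => [_|/eqP li']; first by exists w.
  exact: ex.
- apply: (@realizes_uniq _ (face p (face q x))); first by apply: (P_face q v') => //; lia.
  by rewrite face_face //; apply: (P_face p v) => //; lia.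
have [||vi xvi] := ex i; [lia|lia|].
have zw : face i.+1 z = w by have := zP i.+1; rewrite {1}/P eqxx; apply; lia.
have xz q : q <= m.+3 -> q != i -> q != i.+1 -> realizes (face q x) (face q z).
  by move=> qm qi qi1; have := zP q qm qi; rewrite /P (negbTE qi1).
have zi : face i z = vi.
  apply: composer_eq => [|l lm li]; first lia.
  apply: (@realizes_uniq _ (face l (face i x))); last exact: realizes_face.
  case: (ltngtP l i) => il; last by rewrite il eqxx in li.
    rewrite (face_face z il) ?(face_face x il); try lia.
    by apply/realizes_face/xz; lia.
  rewrite -(face_face (q := l.+1) z) -?(face_face (q := l.+1) x) //; try lia.
  by apply/realizes_face/xz; lia.
(* The i-th face of w is the only one left: it is d_i vi. *)
exists w; apply: (@realizes_of_faces m.+1 x' w) => [|l lm]; first lia.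
case: (eqVneq l i) => [->|]; last exact: wP.
rewrite -zw /x' (face_face z (ltnSn i)) ?(face_face x (ltnSn i)) /= ?zi; try lia.
exact: realizes_face.
Qed.

Lemma realizable_omitted k (x : X k.+2) (j : nat) : k = n -> j = i \/ j = i.+1 ->
  (forall l, l <= k.+2 -> l != j -> realizable (face l x)) ->
  realizable (face j x).
Proof.
move=> kn [->|->]; last exact: realizable_swap.
by move=> ex; apply/realizable_face/realizable_of_horn => //; lia.
Qed.

Lemma realizable_all : (forall x : X n.+1, realizable x) -> forall k (x : X k), realizable x.
Proof.
move=> ex k; elim: k => [|k IH] x; first exact: realizable_low.
case: (ltngtP k n) => kn; first exact: realizable_low.
  by case: k IH x kn => // k IH x nk; apply: realizable_of_horn.
by subst k; apply: ex.
Qed.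

(** Naturality is automatic, as realizers are unique and stable under operators. *)
Lemma realizer_smap : (forall x : X n.+1, realizable x) ->
  exists u : smap X D, forall k (x : X k), realizes x (u k x).
Proof.
move=> /realizable_all ex.
pose u k := projT1 (choice (ex k)).
have uP k (x : X k) : realizes x (u k x) := projT2 (choice (ex k)) x.
have u_nat k l (f : k ~>D l) (x : X l) : u k (act X f x) = act D f (u l x).
  by apply: realizes_uniq (uP _ _) _; apply: realizes_act.
by exists (SMap u_nat).
Qed.
End Realizer.

(** Above dimension n a simplex of D is determined by its faces other than the i-th, so
agreement propagates upwards. *)
Lemma smap_eq (X : sset) (u v : smap X D) : 0 < n ->
  (forall k (x : X k), k <= n -> u k x = v k x) -> u = v.
Proof.
move=> n_gt0 uv; apply: smap_ext => k; elim: k => [|k IH] x; first exact: uv.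
case: (leqP k.+1 n) => kn; first exact: uv.
case: k IH x kn => [|k] IH x kn; first lia.
by apply: composer_eq => // l lk li; rewrite /face -!smap_nat IH.
Qed.
End Composer.

(** * Extending a horn of the function complex *)

Section HornFilling.
Variables (n : nat) (i : 'I_n.+2) (C D : sset).
Hypothesis n_gt0 : 0 < n.
Hypothesis hD : is_composer i D.
Variables (m : nat) (nm : n < m.+2) (h : horn (fun_complex D C) i m).

Let X := sprod C (std m.+2).

Let im : i <= m.+2. Proof. by have := ltn_ord i; lia. Qed.

(** The map from C x Lambda^i[m+2] to D that corresponds to the horn h, as a relation. *)
Definition on_horn k (x : X k) (w : D k) :=
  exists (j : {j : 'I_m.+3 | (j : nat) != i}) (a : k ~>D m.+1),
    x.2 = (delta m.+1 (val j) \o a : k ~>D m.+2) /\ w = h j k (x.1, a).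

Lemma on_horn_act k l (f : k ~>D l) (x : X l) w :
  on_horn x w -> on_horn (act X f x) (act D f w).
Proof.
move=> [j [a [xa ->]]]; exists j, (a \o f); split.
  by rewrite /= xa; apply: mono_ext.
by rewrite -smap_nat.
Qed.

(** If a factors through two cofaces, it factors through their common face, where the
two members of the horn agree. *)
Lemma on_horn_fun k (x : X k) w w' : on_horn x w -> on_horn x w' -> w = w'.
Proof.
move=> [j [a [xa ->]]] [j' [a' [xa' ->]]].
wlog jj' : j j' a a' xa xa' / val j <= val j'.
  move=> H; case: (leqP (val j) (val j')) => jj'; first exact: H.
  by symmetry; apply: H => //; apply: ltnW.
have jm : val j <= m.+2 by have := ltn_ord (val j); rewrite ltnS.
have jm' : val j' <= m.+2 by have := ltn_ord (val j'); rewrite ltnS.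
have e t : delta m.+1 (val j) (a t) = delta m.+1 (val j') (a' t).
  by move: (congr1 (fun f : k ~>D m.+2 => f t) (etrans (esym xa) xa')).
move: jj'; rewrite leq_eqVlt => /orP [/eqP jj'|jj'].
  have {}jj' : j = j' by apply: val_inj; apply: val_inj.
  subst j'; congr (h j k (_, _)); apply: mono_ext => t.
  exact: (delta_inj jm (e t)).
have a'j : misses a' (val j).
  move=> t; have := misses_delta jm (a t); rewrite e deltaE //; lia.
have jm1 : val j <= m.+1 by lia.
have a'E := misses_factor jm1 a'j.
set b : k ~>D m := sigma m (val j).-1 \o a' in a'E.
have aE : a = (delta m (val j').-1 \o b : k ~>D m.+1).
  apply: mono_ext => t; apply: (delta_inj jm); rewrite e a'E.
  exact: (congr1 (fun f : m ~>D m.+2 => f (b t)) (delta_delta jj' jm')).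
have := @horn_compat _ _ _ h _ _ jj'.
move=> /(congr1 (fun u : smap (sprod C (std m)) D => u k (x.1, b))).
by rewrite a'E aE.
Qed.

Lemma on_horn_tot k (x : X k) j : j <= m.+2 -> j != i -> misses x.2 j ->
  exists w, on_horn x w.
Proof.
move=> jm ji xj.
exists (h (exist (fun j : 'I_m.+3 => (j : nat) != i) (Ordinal (jm : j < m.+3)) ji) k
  (x.1, (sigma m.+1 j.-1 \o x.2 : k ~>D m.+1))).
by do 2 eexists; split; [|reflexivity]; apply: misses_factor.
Qed.

(** Every pair (act C a c, a) is the image of this one under the operator a. *)
Definition over_id (c : C m.+2) : X m.+2 := (c, (idfun : m.+2 ~>D m.+2)).

Definition horn_filler (c : C m.+2) (t : D m.+2) :=
  forall l, l <= m.+2 -> l != i -> on_horn (face l (over_id c)) (face l t).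

Lemma horn_filler_ex c : exists t, horn_filler c t.
Proof.
apply: (composer_fill hD nm
  (P := fun l w => on_horn (face l (over_id c)) w)).
  by move=> l lm li; apply: (on_horn_tot lm li) => t; apply: (misses_delta lm).
move=> p q w w' pq qm _ _ xw xw'.
apply: (@on_horn_fun _ (face p (face q (over_id c)))); first exact: on_horn_act.
by rewrite face_face //; apply: on_horn_act.
Qed.

Lemma horn_filler_uniq c t t' : horn_filler c t -> horn_filler c t' -> t = t'.
Proof.
move=> ct ct'; apply: (composer_eq hD nm) => l lm li.
by apply: on_horn_fun; [apply: ct|apply: ct'].
Qed.

Lemma horn_filler_misses c t k (f : k ~>D m.+2) j : horn_filler c t ->
  j <= m.+2 -> j != i -> misses f j ->
  on_horn (act X f (over_id c)) (act D f t).
Proof.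
by move=> ct jm ji fj; rewrite !(act_misses _ jm fj); apply: on_horn_act; apply: ct.
Qed.

(** An extension of h takes a filler t at (s^* b, id), where s is the codegeneracy
numbered i.-1, and hence takes the value face i t at (b, d^i), because s d^i = id. The
operator f closes the relation under operators. *)
Definition on_missing_face k (x : X k) (w : D k) :=
  exists (f : k ~>D m.+1) (b : C m.+1) (t : D m.+2),
    [/\ horn_filler (act C (sigma m.+1 i.-1) b) t, x.1 = act C f b,
        x.2 = (delta m.+1 i \o f : k ~>D m.+2) & w = act D f (face i t)].

Definition prescribed k (x : X k) (w : D k) := on_horn x w \/ on_missing_face x w.

Lemma prescribed_act k l (f : k ~>D l) (x : X l) w :
  prescribed x w -> prescribed (act X f x) (act D f w).
Proof.
case=> [xw|[g [b [t [bt xb xg ->]]]]]; [left; exact: on_horn_act|right].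
exists (g \o f), b, t; split => //.
- by rewrite /= xb act_comp.
- by rewrite /= xg; apply: mono_ext.
by rewrite act_comp.
Qed.

(** Where the pairs (f^* b, d^i f) meet the horn, the filler t takes the values that the
horn imposes. *)
Lemma on_missing_face_misses k (x : X k) w j : j <= m.+2 -> j != i ->
  misses x.2 j -> on_missing_face x w -> on_horn x w.
Proof.
move=> jm ji xj [f [b [t [bt xb xf ->]]]].
rewrite /face -act_comp.
have -> : x = act X (delta m.+1 i \o f) (over_id (act C (sigma m.+1 i.-1) b)).
  case: x xb xf {xj} => c a /= -> ->; rewrite /= /prod_act /=; congr (_, _).
    by rewrite act_comp -[act C (delta _ _) _]act_comp sigma_delta // act_id.
  exact: mono_ext.
by apply: (horn_filler_misses bt jm ji); rewrite -xf.
Qed.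

(** Outside the horn, a pair of dimension at most n is of the form (b, d^i), and there the
filler, hence the value, is determined by b. *)
Lemma prescribed_fun k (x : X k) w w' :
  k <= n -> prescribed x w -> prescribed x w' -> w = w'.
Proof.
move=> kn.
case: (misses_factor_or_onto x.2 im) => [[j jm [ji xj]]|[g og xg]|/onto_dim]; last lia.
  have H v : prescribed x v -> on_horn x v.
    by case=> //; apply: (on_missing_face_misses jm ji xj).
  by move=> /H xw /H; apply: on_horn_fun.
have km : k = m.+1 by have := onto_dim og; lia.
subst k; have gE := onto_id og.
have H v : prescribed x v -> on_missing_face x v.
  case=> // -[j [a [xa _]]].
  have jm : val j <= m.+2 by have := ltn_ord (val j); rewrite ltnS.
  have ji : (val j : nat) != i := valP j.
  have [u fu] : exists u, x.2 u = val j :> nat.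
    move: (nat_of_ord (val j)) jm ji => q qm qi.
    by exists (inord (q - (i < q))); rewrite xg gE deltaE //= inordK; lia.
  have := misses_delta jm (a u).
  have -> : delta m.+1 (val j) (a u) = x.2 u by rewrite xa.
  by rewrite fu eqxx.
have idE (f : m.+1 ~>D m.+1) : x.2 = (delta m.+1 i \o f : m.+1 ~>D m.+2) -> f = idfun.
  move=> xf; rewrite -gE; apply: mono_ext => t; apply: (delta_inj im).
  exact: (congr1 (fun f : m.+1 ~>D m.+2 => f t) (etrans (esym xf) xg)).
move=> /H [f [b [t [bt xb /idE fE ->]]]] /H [f' [b' [t' [bt' xb' /idE fE' ->]]]].
subst f f'; rewrite !act_id in xb xb' *; subst b b'.
by rewrite (horn_filler_uniq bt bt').
Qed.

Lemma on_missing_face_tot (c : C m.+1) (x : X m.+1) :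
  x.1 = c -> x.2 = delta m.+1 i -> exists w, on_missing_face x w.
Proof.
move=> xc xi; have [t ct] := horn_filler_ex (act C (sigma m.+1 i.-1) c).
exists (act D idfun (face i t)), idfun, c, t; split => //; first by rewrite act_id.
by rewrite xi; apply: mono_ext.
Qed.

Lemma prescribed_tot k (x : X k) : k <= n -> exists w, prescribed x w.
Proof.
move=> kn.
case: (misses_factor_or_onto x.2 im) => [[j jm [ji xj]]|[g og xg]|/onto_dim]; last lia.
  by have [w xw] := on_horn_tot jm ji xj; exists w; left.
have km : k = m.+1 by have := onto_dim og; lia.
subst k; have gE := onto_id og.
have [|w xw] := @on_missing_face_tot x.1 x erefl; last by exists w; right.
by rewrite xg gE; apply: mono_ext.
Qed.

Local Notation prescribable := (realizable n (@prescribed)).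

Let prescribable_omitted :=
  realizable_omitted hD prescribed_act prescribed_fun prescribed_tot n_gt0.

Lemma prescribable_misses k (x : X k) j : j <= m.+2 -> j != i ->
  misses x.2 j -> prescribable x.
Proof.
move=> jm ji xj; have [w xw] := on_horn_tot jm ji xj.
by exists w; apply: (R_realizes prescribed_act); left.
Qed.

(** The filler of the horn at (s^* b, id) is a realizer, since its i-th face is the very
value chosen at (b, d^i). *)
Lemma prescribable_over_degenerate (b : C m.+1) : n = m.+1 ->
  prescribable (over_id (act C (sigma m.+1 i.-1) b)).
Proof.
move=> nE; have [t ct] := horn_filler_ex (act C (sigma m.+1 i.-1) b).
exists t; apply: (realizes_of_faces (k := m.+1)) => [|l lm]; first lia.
apply: (R_realizes prescribed_act).
case: (eqVneq l i) => [->|li]; last by left; apply: ct.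
right; exists idfun, b, t; split => //=.
- by rewrite act_id -act_comp sigma_delta // act_id.
- exact: mono_ext.
by rewrite act_id.
Qed.

(** For i = 0 take e = s_1 c: then (e, s^0) has the faces d_0 = (s_0 d_0 c, id) and
d_1 = (c, id). For i > 0 take e = s_(i-1) c: then (e, s^i) has the faces
d_i = (c, id) and d_(i+1) = (s_(i-1) d_i c, id). The other faces of s^i omit a vertex
different from i, so they lie over the horn. *)
Lemma prescribable_over_id (c : C m.+2) : n = m.+1 -> prescribable (over_id c).
Proof.
move=> nE.
(* j is the number of the face (c, id), and the equation e treats the one among i and
   i + 1 that is not j. *)
have [p [j [jp ji jm pm e]]] : exists p j : nat,
  [/\ (sigma m.+2 p \o delta m.+2 j : m.+2 ~>D m.+2) = idfun,
    j = i \/ j = i.+1, j <= m.+3, p <= m.+2 &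
    (sigma m.+2 p \o delta m.+2 (if j == i :> nat then i.+1 else i) : m.+2 ~>D m.+2) =
    (delta m.+1 i \o sigma m.+1 i.-1 : m.+2 ~>D m.+2)].
  case: (posnP i) => i0.
    exists 1, 1; rewrite i0 /=; split => //; try (by right).
      by apply: val_mono_ext => t; rewrite [LHS]sigmaE ?deltaE //=; lia.
    by apply: val_mono_ext => t; rewrite [LHS]sigmaE // [RHS]deltaE ?deltaE ?sigmaE //; lia.
  exists i.-1, i; rewrite eqxx; split => //; try (by left); try lia.
    by apply: sigma_delta; lia.
  by apply: val_mono_ext => t; rewrite [LHS]sigmaE ?[RHS]deltaE ?deltaE ?sigmaE //; lia.
pose x : X m.+3 := (act C (sigma m.+2 p) c, sigma m.+2 i).
have xi (l : nat) : l = i \/ l = i.+1 -> (face l x).2 = (idfun : m.+2 ~>D m.+2).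
  by case=> ->; apply: val_mono_ext => t; rewrite [LHS]sigmaE ?deltaE //=; lia.
have -> : over_id c = face j x.
  rewrite [RHS]surjective_pairing xi //; congr (_, _).
  by rewrite /= -act_comp jp act_id.
apply: prescribable_omitted => // l lm lj.
case: (eqVneq l (if j == i :> nat then i.+1 else i)) => [lE|li].
  have -> : face l x = over_id (act C (sigma m.+1 i.-1) (face i c)).
    rewrite [LHS]surjective_pairing xi; last by rewrite lE; case: ifP; [right|left].
    by congr (_, _); rewrite /= -!act_comp -e -lE.
  exact: prescribable_over_degenerate.
have [{lj} li li1] : l != i /\ l != i.+1.
  case: ji lj li => ->; first by rewrite eqxx.
  by have /negbTE -> : i.+1 != i by lia.
apply: (@prescribable_misses _ _ (l - (i < l))); [lia|lia|].
move=> t; have -> : (face l x).2 t = delta m.+2 l t - (i < delta m.+2 l t) :> nat.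
  by rewrite -sigmaE.
by rewrite deltaE //; lia.
Qed.

(** The value i has to be inserted into d^i g without breaking monotonicity. Since
t - 1 <= g t <= t, the position is i if i <= g i, and i + 1 otherwise. *)
Lemma prescribable_degenerate (x : X m.+2) (g : m.+2 ~>D m.+1) : n = m.+1 ->
  onto g -> x.2 = (delta m.+1 i \o g : m.+2 ~>D m.+2) -> prescribable x.
Proof.
move=> nE og xg; have gb := onto_bounds og.
have xE t : x.2 t = (i <= g t) + g t :> nat by rewrite xg [LHS]deltaE.
have [j [ji jm lo hi]] : exists j : nat, [/\ j = i \/ j = i.+1, j <= m.+3,
    forall t : 'I_m.+3, t < j -> x.2 t <= i & forall t : 'I_m.+3, j <= t -> i <= x.2 t].
  have im' : i < m.+3 by rewrite ltnS.
  set s := Ordinal im'.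
  case: (leqP i (g s)) => gs; [exists i|exists i.+1]; split; try (by [left|right]); try lia.
  - by move=> t ti; rewrite xE; have := gb t; lia.
  - by move=> t ti; rewrite xE; have := @mono_le _ _ g s t ti; lia.
  - by move=> t ti; rewrite xE; have := @mono_le _ _ g t s ti; lia.
  - by move=> t ti; rewrite xE; have := gb t; lia.
have [a ax aj] := insert_value im jm lo hi.
pose y : X m.+3 := (act C (sigma m.+2 j.-1) x.1, a).
have -> : x = face j y.
  rewrite [LHS]surjective_pairing; congr (_, _); last by rewrite -ax.
  by rewrite -act_comp sigma_delta // act_id.
apply: prescribable_omitted => // l lm lj.
case: (misses_factor_or_onto (face l y).2 im) => [[q qm [qi yq]]|[f _ yf]|/onto_id yid].
- exact: (prescribable_misses qm qi yq).
(* This face still takes the value i, at the position u that l sends to j, so it does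
   not factor through d^i. *)
- pose u : 'I_m.+3 := inord (j - (l < j)).
  have du : delta m.+2 l u = j :> nat by rewrite deltaE // inordK; lia.
  have := misses_delta im (f u).
  have -> : delta m.+1 i (f u) = (face l y).2 u by rewrite yf.
  by rewrite [X in X != _](aj _ du) eqxx.
have -> : face l y = over_id (face l y).1 by rewrite [LHS]surjective_pairing yid.
exact: prescribable_over_id.
Qed.

(** In dimensions at most n + 1, a pair outside the horn is either (c, d^i), whose value
has been chosen, or, only if n = m + 1, of one of the two kinds treated above. *)
Lemma prescribable_low k (z : X k) : k <= n.+1 -> prescribable z.
Proof.
move=> kn.
case: (misses_factor_or_onto z.2 im) => [[j jm [ji zj]]|[g og zg]|oz].
- exact: (prescribable_misses jm ji zj).
- have := onto_dim og; rewrite leq_eqVlt => /orP [/eqP km|mk].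
    subst k; have gE := onto_id og.
    have [|w zw] := @on_missing_face_tot z.1 z erefl.
      by rewrite zg gE; apply: mono_ext.
    by exists w; apply: (R_realizes prescribed_act); right.
  have km : k = m.+2 by lia.
  subst k; apply: (prescribable_degenerate _ og zg); lia.
have km : k = m.+2 by have := onto_dim oz; lia.
subst k; have zid := onto_id oz.
have -> : z = over_id z.1 by rewrite [LHS]surjective_pairing zid.
by apply: prescribable_over_id; lia.
Qed.

Lemma horn_extension : exists u : fun_complex D C m.+2, boundary_horn i u = h.
Proof.
have [u uP] := realizer_smap hD prescribed_act prescribed_fun prescribed_tot n_gt0
  (fun x => prescribable_low x (leqnn _)).
exists u; apply: horn_ext => j; apply: smap_ext => k [c a].
pose x : X k := (c, (delta m.+1 (val j) \o a : k ~>D m.+2)).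
apply: (realizes_uniq hD prescribed_fun n_gt0 (uP k x)).
by apply: (R_realizes prescribed_act); left; exists j, a.
Qed.

End HornFilling.

(** An extension of a horn is determined at the pairs (s^* b, id) by horn filling in D,
hence at their i-th faces (b, d^i); the pairs of dimension at most n that are not of
this form lie over the horn. *)
Lemma fun_complex_horn_inj (n : nat) (i : 'I_n.+2) (C D : sset) m :
  0 < n -> is_composer i D -> n < m.+2 ->
  injective (@boundary_horn (fun_complex D C) i m).
Proof.
move=> n_gt0 hD nm u v uv; have im : i <= m.+2 by have := ltn_ord i; lia.
have E k (x : sprod C (std m.+2) k) j : j <= m.+2 -> j != i -> misses x.2 j -> u k x = v k x.
  move=> jm ji xj; case: x xj => c a /= /(misses_factor jm) ->.
  have := congr1 (fun h : horn (fun_complex D C) i m => h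
    (exist (fun j : 'I_m.+3 => (j : nat) != i) (Ordinal (jm : j < m.+3)) ji)) uv.
  by move=> /(congr1 (fun w : smap (sprod C (std m.+1)) D =>
    w k (c, (sigma m.+1 j.-1 \o a : k ~>D m.+1)))).
apply: (smap_eq hD n_gt0) => k x kn.
case: (misses_factor_or_onto x.2 im) => [[j jm [ji xj]]|[g og xg]|/onto_dim]; last lia.
  exact: E xj.
have km : k = m.+1 by have := onto_dim og; lia.
subst k; have gE := onto_id og.
pose y : sprod C (std m.+2) m.+2 := (act C (sigma m.+1 i.-1) x.1, (idfun : m.+2 ~>D m.+2)).
have -> : x = face i y.
  rewrite [LHS]surjective_pairing; congr (_, _); last by rewrite xg gE; apply: mono_ext.
  by rewrite -act_comp sigma_delta // act_id.
rewrite /face !smap_nat; congr (act D _ _); apply: (composer_eq hD nm) => l lm li.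
by rewrite /face -!smap_nat; apply: (E _ _ l) => // t; apply: (misses_delta lm).
Qed.

Theorem theorem39 (n : nat) (hn : 1 <= n) (i : 'I_n.+2) (C D : sset)
  (hC : is_composer i C) (hD : is_composer i D) :
  is_composer i (fun_complex D C).
Proof.
move=> m nm; apply: bijective_of_inj_surj => [|h].
  exact: fun_complex_horn_inj.
exact: horn_extension.
Qed.
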